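(* A finite simple type system on $\Omega$ is either nuclear, atomic binuclear, or atomic quasinuclear.
   Context: $\Omega$ is the set of all finite words over $\{0,1\}$ (including the empty word), called addresses; $|\alpha|$ is the length of $\alpha$. A type system on $\Omega$ is the partition $\mathcal{P}$ of $\Omega$ into the classes (called types) of an equivalence relation $\sim$ such that for all $\alpha,\beta\in\Omega$: $\alpha\sim\beta$ if and only if both $\alpha0\sim\beta0$ and $\alpha1\sim\beta1$. It is finite if it has only finitely many classes. A type system $\mathcal{Q}$ (relation $\approx$) is a quotient of $\mathcal{P}$ (relation $\sim$) if $\alpha\sim\beta$ implies $\alpha\approx\beta$; it is proper if $\mathcal{Q}\ne\mathcal{P}$. The universal relation is the one in which all addresses are related. $\mathcal{P}$ is simple if its only proper quotient is the type system of the universal relation (in particular the universal type system itself is not simple). For $P\in\mathcal{P}$ and $\gamma\in\Omega$, $P_\gamma$ denotes the type of $\alpha\gamma$ for any $\alpha\in P$ (well defined). Let $\mathcal{S}\subseteq\mathcal{P}$ be non-empty. $\mathcal{S}$ is child-closed if $P\in\mathcal{S}$ implies $P_0,P_1\in\mathcal{S}$. $\mathcal{S}$ is strongly connected if for all $P,Q\in\mathcal{S}$ there is a non-empty word $\gamma$ with $P_\gamma=Q$ and $P_\zeta\in\mathcal{S}$ for every prefix $\zeta$ of $\gamma$. $\mathcal{S}$ is a nucleus if it is child-closed and strongly connected. $\mathcal{P}$ is multinuclear if there are a positive integer $t$ and disjoint nuclei $\mathcal{Q}^{(1)},\dots,\mathcal{Q}^{(k)}\subseteq\mathcal{P}$ such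 that every address $\alpha$ with $|\alpha|\ge t$ has type in one of the $\mathcal{Q}^{(i)}$. It is nuclear if this holds with $k=1$, and binuclear if this holds with $k=2$. It is atomic binuclear if it is binuclear and each of its two nuclei consists of a single type. $\mathcal{P}$ is quasinuclear if there are a positive integer $t$ and non-empty disjoint subsets $\mathcal{Q},\mathcal{R}\subseteq\mathcal{P}$ such that: (a) every address $\alpha$ with $|\alpha|\geq t$ has type in $\mathcal{Q}\cup\mathcal{R}$; (b) $\mathcal{R}$ is a nucleus; (c) $\mathcal{Q}$ is strongly connected; (d) $\mathcal{Q}\cup\mathcal{R}$ is child-closed; (e) for all $Q\in\mathcal{Q}$ and $R\in\mathcal{R}$ there is a word $\gamma$ with $Q_\gamma=R$. It is atomic quasinuclear if moreover $\mathcal{R}$ consists of a single type. *)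

(* Defs.v *)
From mathcomp Require Import all_boot.
From mathcomp Require Import boolp classical_sets cardinality.

Set Implicit Arguments.
Unset Strict Implicit.
Unset Printing Implicit Defensive.

Local Open Scope classical_set_scope.

(* Finite words over {0,1}, with 0 = false and 1 = true. *)
Definition address := seq bool.

(* A type system is given by its equivalence relation; the partition itself is
   [types] below, and type systems are compared through their partitions. *)
Record type_system := TypeSystem {
  same_type : address -> address -> Prop;
  same_type_refl : forall a, same_type a a;
  same_type_sym : forall a b, same_type a b -> same_type b a;
  same_type_trans : forall a b c,
    same_type a b -> same_type b c -> same_type a c;
  same_type_children : forall a b,
    same_type a b <->
    same_type (rcons a false) (rcons b false) /\
    same_type (rcons a true) (rcons b true)
}.

Definition type_of (P : type_system) (a : address) : set address :=
  [set b | same_type P a b].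

Definition types (P : type_system) : set (set address) :=
  [set A | exists a, A = type_of P a].

Definition finite_type_system (P : type_system) : Prop :=
  finite_set (types P).

Definition quotient (Q P : type_system) : Prop :=
  forall a b, same_type P a b -> same_type Q a b.

Definition proper_quotient (Q P : type_system) : Prop :=
  quotient Q P /\ types Q <> types P.

Definition universal_type_system : type_system.
Proof. by exists (fun _ _ => True). Defined.

(* The right-to-left direction says that the universal type system is itself a
   proper quotient of P, so that it is not simple. *)
Definition simple (P : type_system) : Prop :=
  forall Q : type_system,
    proper_quotient Q P <-> types Q = types universal_type_system.

(* For a type A of P, this is A_g: the set of addresses related to a ++ g for
   some a in A, i.e. the type of a ++ g for any a in A. *)
Definition descendant (P : type_system) (A : set address) (g : address) :
    set address :=
  [set b | exists2 a, A a & same_type P (a ++ g) b].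

Definition child_closed (P : type_system) (S : set (set address)) : Prop :=
  forall A, S A ->
    S (descendant P A [:: false]) /\ S (descendant P A [:: true]).

Definition strongly_connected (P : type_system) (S : set (set address)) :
    Prop :=
  forall A B, S A -> S B ->
    exists g : address, [/\ g <> [::], descendant P A g = B
      & forall z : address, prefix z g -> S (descendant P A z)].

Definition nucleus (P : type_system) (S : set (set address)) : Prop :=
  [/\ S `<=` types P, S !=set0, child_closed P S & strongly_connected P S].

Definition multinuclear_decomposition (P : type_system) (k : nat)
    (Q : 'I_k -> set (set address)) : Prop :=
  [/\ forall i, nucleus P (Q i),
      forall i j, i <> j -> Q i `&` Q j = set0
    & exists2 t : nat, 0 < t &
        forall a : address, t <= size a -> exists i, Q i (type_of P a)].

Definition multinuclear (P : type_system) : Prop :=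
  exists (k : nat) (Q : 'I_k -> set (set address)),
    multinuclear_decomposition P Q.

Definition nuclear (P : type_system) : Prop :=
  exists Q : 'I_1 -> set (set address), multinuclear_decomposition P Q.

Definition binuclear (P : type_system) : Prop :=
  exists Q : 'I_2 -> set (set address), multinuclear_decomposition P Q.

Definition single_type (S : set (set address)) : Prop :=
  exists A, S = [set A].

Definition atomic_binuclear (P : type_system) : Prop :=
  exists2 Q : 'I_2 -> set (set address),
    multinuclear_decomposition P Q & forall i, single_type (Q i).

Record quasinuclear_decomposition (P : type_system)
    (Q R : set (set address)) : Prop := QuasinuclearDecomposition {
  quasi_subQ : Q `<=` types P;
  quasi_subR : R `<=` types P;
  quasi_Q0 : Q !=set0;
  quasi_R0 : R !=set0;
  quasi_disjoint : Q `&` R = set0;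
  quasi_long : exists2 t : nat, 0 < t &
    forall a : address, t <= size a -> (Q `|` R) (type_of P a);
  quasi_nucleus : nucleus P R;
  quasi_connected : strongly_connected P Q;
  quasi_closed : child_closed P (Q `|` R);
  quasi_reach : forall A B, Q A -> R B -> exists g, descendant P A g = B
}.

Definition quasinuclear (P : type_system) : Prop :=
  exists Q R, quasinuclear_decomposition P Q R.

Definition atomic_quasinuclear (P : type_system) : Prop :=
  exists Q R, quasinuclear_decomposition P Q R /\ single_type R.

(* Main.v *)
(** Types form a finite deterministic automaton in which a type is determined
    by its two children.  If [S] is child-closed and has at least two elements,
    collapsing [S] to a point (and identifying addresses whose long descendants
    become equal) is a proper quotient, so by simplicity it is universal; this
    forces all long addresses to have type in [S].

    Apply this to a nucleus with two elements (nuclear case), to [S = {R, R'}]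
    for two distinct one-element nuclei [{R}] and [{R'}] (atomic binuclear
    case), and otherwise, [{R}] being the only nucleus, to a minimal
    child-closed [S] properly containing [{R}] (atomic quasinuclear case with
    [Q = S \ {R}]). *)
From mathcomp Require Import all_boot finmap.
From mathcomp Require Import boolp classical_sets cardinality.
Require Import Defs.

Set Implicit Arguments.
Unset Strict Implicit.
Unset Printing Implicit Defensive.

Local Open Scope classical_set_scope.

(** A set of least cardinality among those inside [X] that satisfy [F] is minimal for inclusion. *)
Lemma finite_set_minimal (T : choiceType) (F : set T -> Prop) (X : set T) :
  finite_set X -> F X ->
  exists Y, [/\ Y `<=` X, F Y & forall Z, Z `<=` Y -> F Z -> Z = Y].
Proof.
move=> finX FX.
pose C n := `[< exists Y, [/\ Y `<=` X, F Y & #|` fset_set Y| = n] >].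
have exC : exists n, C n.
  by exists #|` fset_set X|; apply/asboolP; exists X; split.
have [n /asboolP[Y [YX FY cardY]] minY] := ex_minnP exC.
exists Y; split=> // Z ZY FZ.
have finY := sub_finite_set YX finX; have finZ := sub_finite_set ZY finY.
apply/(fset_set_inj finZ finY)/eqP.
rewrite eqEfcard; apply/andP; split; first by rewrite -fset_set_sub.
rewrite cardY; apply: minY; apply/asboolP; exists Z; split=> //; exact: subset_trans YX.
Qed.

(** * Types, their descendants, and nuclei *)

Section TypeSystem.
Variable P : type_system.
Implicit Types (a b g : address) (A B : set address).
Implicit Types S : set (set address).

Lemma same_type_cat a b g : same_type P a b -> same_type P (a ++ g) (b ++ g).
Proof.
elim: g a b => [|x g IH] a b; first by rewrite !cats0.
move=> /same_type_children[ab0 ab1]; rewrite -!cat_rcons.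
by case: x; apply: IH.
Qed.

Lemma type_ofP a b : type_of P a = type_of P b <-> same_type P a b.
Proof.
split=> [E|ab].
  by rewrite -[same_type P a b]/(type_of P a b) E; apply: same_type_refl.
apply/seteqP; split=> c; apply: same_type_trans => //; exact: same_type_sym.
Qed.

Lemma descendant_type_of a g :
  descendant P (type_of P a) g = type_of P (a ++ g).
Proof.
apply/seteqP; split=> b /=.
  case=> c ac; apply: same_type_trans; exact: same_type_cat.
by move=> ab; exists a => //; apply: same_type_refl.
Qed.

Lemma types_descendant A g : types P A -> types P (descendant P A g).
Proof. by case=> a ->; rewrite descendant_type_of; exists (a ++ g). Qed.

Lemma descendant_nil A : types P A -> descendant P A [::] = A.
Proof. by case=> a ->; rewrite descendant_type_of cats0. Qed.

Lemma descendant_cat A g h : types P A ->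
  descendant P A (g ++ h) = descendant P (descendant P A g) h.
Proof. by case=> a ->; rewrite !descendant_type_of catA. Qed.

(** This is the right-to-left half of [same_type_children], which distinguishes type systems among
    right congruences on words. *)
Lemma descendant_inj A B : types P A -> types P B ->
  (forall x, descendant P A [:: x] = descendant P B [:: x]) -> A = B.
Proof.
move=> [a ->] [b ->] AB; apply/type_ofP/same_type_children.
by split; apply/type_ofP; rewrite -!cats1 -!descendant_type_of.
Qed.

Lemma child_closed_child S A x :
  child_closed P S -> S A -> S (descendant P A [:: x]).
Proof. by move=> cS /cS[S0 S1]; case: x. Qed.

Lemma child_closed_descendant S A g : child_closed P S -> types P A ->
  S A -> S (descendant P A g).
Proof.
move=> cS; elim: g A => [|x g IH] A TA SA; first by rewrite descendant_nil.
rewrite -cat1s descendant_cat //; apply: IH; first exact: types_descendant.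
exact: child_closed_child.
Qed.

Lemma child_closed_types : child_closed P (types P).
Proof. by move=> A TA; split; apply: types_descendant. Qed.

Lemma child_closed_setU S1 S2 :
  child_closed P S1 -> child_closed P S2 -> child_closed P (S1 `|` S2).
Proof.
by move=> c1 c2 A [/c1|/c2] [? ?]; split; [left|left|right|right].
Qed.

Definition descendants A := [set descendant P A g | g in setT].

Lemma descendants_self A : types P A -> descendants A A.
Proof. by move=> TA; exists [::] => //; apply: descendant_nil. Qed.

Lemma child_closed_descendants A : types P A -> child_closed P (descendants A).
Proof.
move=> TA _ [g _ <-].
by split; rewrite -descendant_cat //; eexists.
Qed.

Lemma descendants_sub S A : child_closed P S -> types P A -> S A ->
  descendants A `<=` S.
Proof. by move=> cS TA SA _ [g _ <-]; apply: child_closed_descendant. Qed.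

(** A minimal non-empty child-closed subset [N] of [S] is a nucleus: the descendants of any member
    of [N] again form such a subset, hence exhaust [N]. *)
Lemma exists_nucleus_sub S : finite_type_system P -> S `<=` types P ->
  S !=set0 -> child_closed P S -> exists2 N, N `<=` S & nucleus P N.
Proof.
move=> finP ST S0 cS.
have [N [NS [N0 cN] minN]] := @finite_set_minimal _
  (fun N => N !=set0 /\ child_closed P N) S (sub_finite_set ST finP)
  (conj S0 cS).
have NT := subset_trans NS ST.
exists N => //; split=> // A B NA NB.
(* Starting from a child of [A] guarantees that the word leading to [B] is non-empty. *)
pose A' := descendant P A [:: false].
have NA' : N A' by apply: child_closed_child.
have TA' : types P A' by apply: NT.
have : descendants A' B.
  rewrite (minN (descendants A')) //; first exact: descendants_sub.
  split; last exact: child_closed_descendants.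
  by exists A'; apply: descendants_self.
case=> g _ gB; exists (false :: g); split=> //.
  by rewrite -cat1s descendant_cat //; apply: NT.
by move=> z _; apply: child_closed_descendant => //; apply: NT.
Qed.

(** * Collapsing a set of types to a point *)

Section Collapse.
Variable S : set (set address).

(** Being equivalent or both in [S] need not pass from the children back to the parents. Ignoring
    finitely many levels, through the bound [n], repairs this. *)
Definition collapse_rel a b := exists n, forall g, n <= size g ->
  same_type P (a ++ g) (b ++ g) \/
  S (type_of P (a ++ g)) /\ S (type_of P (b ++ g)).

Lemma collapse_refl a : collapse_rel a a.
Proof. by exists 0 => g _; left; apply: same_type_refl. Qed.

Lemma collapse_sym a b : collapse_rel a b -> collapse_rel b a.
Proof.
case=> n H; exists n => g /H[ab|[]]; last by right.
by left; apply: same_type_sym.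
Qed.

Lemma collapse_trans a b c :
  collapse_rel a b -> collapse_rel b c -> collapse_rel a c.
Proof.
move=> [m H] [n K]; exists (maxn m n) => g; rewrite geq_max => /andP[/H Hg /K].
case: Hg => [ab|[Sa Sb]] [bc|[Sb' Sc]].
- by left; apply: same_type_trans bc.
- by right; split=> //; rewrite (proj2 (type_ofP _ _) ab).
- by right; split=> //; rewrite -(proj2 (type_ofP _ _) bc).
- by right.
Qed.

Lemma collapse_children a b : collapse_rel a b <->
  collapse_rel (rcons a false) (rcons b false) /\
  collapse_rel (rcons a true) (rcons b true).
Proof.
split=> [[n H]|[[m H] [n K]]].
  by split; exists n => g ng; rewrite !cat_rcons; apply: H; apply: leqW.
(* The extra level accounts for the first letter of the word and rules out the empty word. *)
exists (maxn m n).+1 => -[//|x g]; rewrite ltnS geq_max => /andP[mg ng].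
by rewrite -!cat_rcons; case: x; [apply: K | apply: H].
Qed.

Definition collapse := TypeSystem collapse_refl collapse_sym collapse_trans
  collapse_children.

Lemma simple_child_closed_long A B : simple P -> S `<=` types P ->
  child_closed P S -> S A -> S B -> A <> B ->
  exists2 t, 0 < t & forall a, t <= size a -> S (type_of P a).
Proof.
move=> simP ST cS SA SB AB.
case: (ST _ SA) (ST _ SB) => a Aa [b Bb]; rewrite {}Aa {}Bb in SA SB AB.
have Sg c g : S (type_of P c) -> S (type_of P (c ++ g)).
  by rewrite -descendant_type_of; apply: child_closed_descendant => //; exists c.
have cab : collapse_rel a b by exists 0 => g _; right; split; apply: Sg.
have /simP univ : proper_quotient collapse P.
  split=> [c d cd|eqT]; first by exists 0 => g _; left; apply: same_type_cat.
  (* If the partitions agreed, the collapsed class of [a] would be a type of [P] containing [b],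
     although [a] and [b] have different types. *)
  have [c Ec] : types P (type_of collapse a) by rewrite -eqT; exists a.
  have ca : type_of P c a by rewrite -Ec; apply: collapse_refl.
  have cb : type_of P c b by rewrite -Ec.
  by apply: AB; rewrite -((type_ofP _ _).2 ca) -((type_ofP _ _).2 cb).
(* Universality relates the empty word to [a]: for long [g], either [g] has the type of [a ++ g],
   which lies in [S], or its own type lies in [S]. The successor in [n.+1] only makes the bound
   positive. *)
have [c Ec] : types universal_type_system (type_of collapse [::]).
  by rewrite -univ; exists [::].
have [n H] : type_of collapse [::] a by rewrite Ec.
exists n.+1 => // g /ltnW /H[|[]//].
by move=> /type_ofP /= ->; apply: Sg.
Qed.

End Collapse.

(** * The three kinds of simple type system *)

Lemma nucleus_nuclear S : nucleus P S ->
  (exists2 t, 0 < t & forall a, t <= size a -> S (type_of P a)) -> nuclear P.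
Proof.
move=> nS [t t0 H]; exists (fun=> S); split=> // [i j|].
  by rewrite (ord1 i) (ord1 j).
by exists t => // a /H; exists ord0.
Qed.

Lemma nucleus_pair_nuclear S A B : simple P -> nucleus P S ->
  S A -> S B -> A <> B -> nuclear P.
Proof.
move=> simP nS SA SB AB; apply: (nucleus_nuclear nS).
by case: nS => *; apply: (simple_child_closed_long (A := A) (B := B)).
Qed.

Lemma atom_nuclei_binuclear R1 R2 : simple P -> nucleus P [set R1] ->
  nucleus P [set R2] -> R1 <> R2 -> atomic_binuclear P.
Proof.
move=> simP n1 n2 R12.
exists (fun i => [set if i == ord0 then R1 else R2]); last first.
  by move=> i; eexists.
split=> [i|i j ij|]; first by case: (i == ord0).
  apply/seteqP; split=> // A [/= ->].
  case: i j ij => -[|[|//]] ? [[|[|//]] ?] ij //= E;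
    by [case: ij; apply/val_inj | case: R12].
have [t t0 H] : exists2 t, 0 < t &
    forall a, t <= size a -> ([set R1] `|` [set R2]) (type_of P a).
  case: n1 n2 => T1 _ c1 _ [T2 _ c2 _].
  apply: (simple_child_closed_long (A := R1) (B := R2)) => //.
  - by move=> A [/T1|/T2].
  - exact: child_closed_setU.
  - by left.
  - by right.
exists t => // a /H[/= ->|/= ->]; first by exists ord0.
by exists (lift ord0 ord0).
Qed.

Lemma atom_quasinuclear R : finite_type_system P -> simple P ->
  nucleus P [set R] -> (forall N, nucleus P N -> N = [set R]) ->
  types P <> [set R] -> atomic_quasinuclear P.
Proof.
move=> finP simP nR uniqR TR.
have [RT _ cR _] := nR; have TRR : types P R by apply: RT.
have Rg g : descendant P R g = R.
  exact: (child_closed_descendant (S := [set R])).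
(* The child-closed sets properly containing [[set R]]. *)
pose F S := [/\ child_closed P S, S R & exists2 A, S A & A <> R].
have FT : F (types P).
  split=> //; first exact: child_closed_types.
  apply: contrapT => noA; apply: TR; apply/seteqP; split=> [A TA|A ->//].
  by apply: contrapT => AR; apply: noA; exists A.
have [S [ST [cS SR [A0 SA0 A0R]] minS]] := finite_set_minimal finP FT.
have SE : (S `\ R) `|` [set R] = S.
  apply/seteqP; split=> [A [[]//|->//]|A SA].
  by have [->|AR] := pselect (A = R); [right | left].
exists (S `\ R), [set R]; split; last by exists R.
have [t t0 long] := simple_child_closed_long simP ST cS SA0 SR A0R.
split=> //.
- by move=> A [/ST].
- by exists A0.
- by exists R.
- by apply/seteqP; split=> // A [[]].
- by exists t => // a /long; rewrite SE.
- move=> A B [SA AR] [SB BR].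
  have TA := ST _ SA.
  (* Since [R] is its own child on both sides, a type with both children [R] would be [R] itself.
     The descendants of the child [A'] other than [R], together with [R], satisfy [F], so minimality
     makes them all of [S] and [B] is reached. *)
  have [x xR] : exists x, descendant P A [:: x] <> R.
    apply: contrapT => noX; apply: AR; apply: descendant_inj => // x.
    by rewrite Rg; apply: contrapT => xR; apply: noX; exists x.
  pose A' := descendant P A [:: x].
  have SA' : S A' by apply: child_closed_child.
  have TA' := ST _ SA'.
  have : ([set R] `|` descendants A') B.
    rewrite (minS ([set R] `|` descendants A')) //.
      by move=> C [->//|]; apply: descendants_sub.
    split; [|by left|by exists A' => //; right; apply: descendants_self].
    by apply: child_closed_setU => //; apply: child_closed_descendants.
  case=> [//|[g _ gB]]; exists (x :: g).
  have xgB : descendant P A (x :: g) = B by rewrite -cat1s descendant_cat.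
  split=> // z /prefixP[w xgE]; split; first exact: child_closed_descendant.
  (* A path that meets [R] stays there, so it could not end in [B]. *)
  by move=> /= zR; apply: BR; rewrite -xgB xgE descendant_cat // zR Rg.
- by rewrite SE.
- move=> A _ [SA _] ->; have TA := ST _ SA.
  (* The descendants of [A] contain a nucleus, which can only be [[set R]]. *)
  have [N NA /uniqR NE] : exists2 N, N `<=` descendants A & nucleus P N.
    apply: exists_nucleus_sub => //; last exact: child_closed_descendants.
      by apply: descendants_sub => //; apply: child_closed_types.
    by exists A; apply: descendants_self.
  by have [g _ gR] : descendants A R by [apply: NA; rewrite NE]; exists g.
Qed.

End TypeSystem.

Theorem theorem4p8 (P : type_system) (Pfin : finite_type_system P)
  (Psimple : simple P) :
  nuclear P \/ atomic_binuclear P \/ atomic_quasinuclear P.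
Proof.
have [|Pn] := pselect (nuclear P); first by left.
right; have [|Pb] := pselect (atomic_binuclear P); first by left.
right.
have atom N : nucleus P N -> exists2 R, N = [set R] & nucleus P [set R].
  move=> nN; have [_ [R NR] _ _] := nN.
  have NE : N = [set R].
    apply/seteqP; split=> [A NA|A ->//]; apply: contrapT => AR.
    exact/Pn/(nucleus_pair_nuclear Psimple nN NA NR).
  by exists R; rewrite -?NE.
have [N _ /atom[R _ nR]] : exists2 N, N `<=` types P & nucleus P N.
  apply: exists_nucleus_sub => //; last exact: child_closed_types.
  by exists (type_of P [::]); exists [::].
apply: (atom_quasinuclear Pfin Psimple nR) => [M /atom[R' -> nR']|TR].
  congr [set _]; apply: contrapT => RR'.
  exact/Pb/(atom_nuclei_binuclear Psimple nR' nR).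
(* If [R] were the only type, every address would have type [R] and [P] would be nuclear. *)
apply/Pn/(nucleus_nuclear nR); exists 1 => // a _.
by rewrite -TR; exists a.
Qed.
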